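(* There is no social choice function (for facility location on $[0,1]$ with single-peaked preferences and tree-shaped invitation networks) that simultaneously satisfies strategy-proofness over networks (SP), Pareto efficiency (PE), and anonymity on structures (AN-S).
   Context: Outcomes and preferences. The outcome set is $\mathcal{O}=[0,1]$. A preference is a complete and transitive binary relation $\succsim$ on $\mathcal{O}$ (strict part $\succ$). It is single-peaked if there is a point $p\in\mathcal{O}$ (its peak) such that for all distinct $x,y\in\mathcal{O}$: if $p\le x<y$ or $y<x\le p$ then $x\succ y$. Let $\mathcal{R}$ be the set of all single-peaked preferences. The peak of voter $i$'s preference $\succ_i$ is denoted $p_i$. Networks and types. $\mathcal{N}$ is an infinite set of potential voters and $m\notin\mathcal{N}$ is the moderator. A type of voter $i$ is a pair $\theta_i=(\succ_i,r_i)$ with $\succ_i\in\mathcal{R}$ and $r_i\subseteq\mathcal{N}\setminus\{i\}$ finite ($r_i$ is the set of children of $i$). An instance consists of a nonempty finite $N\subseteq\mathcal{N}$, a nonempty set $r_m\subseteq N$ (the children of $m$), and a type profile $\theta=(\theta_i)_{i\in N}$ with $r_i\subseteq N$ for all $i$, such that the directed graph $G$ on $N\cup\{m\}$ with an edge from $m$ to each element of $r_m$ and from $i$ to each element of $r_i$ ($i\in N$) is a directed tree rooted at $m$ (every $i\in N$ is reached by exactly one directed path from $m$, and there are no other edges). Reports. A voter with true type $\theta_i=(\succ_i,r_i)$ can report any element of $R(\theta_i)=\{(\succ_i',r_i') : \succ_i'\in\mathcal{R},\ r_i'\subseteq r_i\}$. Write $\theta_{-i}=(\theta_j)_{j\in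 N\setminus\{i\}}$, and $\theta'_{-i}\in R(\theta_{-i})$ if $\theta_j'\in R(\theta_j)$ for all $j\ne i$. Given a reported profile $\theta'$, the participating voters $\hat N(\theta')$ are those reachable from $m$ by a directed path in the graph formed by $r_m$ and the reported $r_i'$; restricting $\theta'$ to $\hat N(\theta')$ gives again an instance (with the same $r_m$). Social choice function (SCF). An SCF $f$ is a (deterministic) map assigning to every instance an outcome in $\mathcal{O}$. For a reported profile $\theta'$, $f(\theta')$ denotes the value of $f$ at the restriction of $\theta'$ to $\hat N(\theta')$ (with $r_m$ unchanged); so it depends only on $r_m$ and the participants' reports. SP. $f$ is strategy-proof over networks if for every instance $(N,r_m,\theta)$, every $i\in N$, every $\theta'_{-i}\in R(\theta_{-i})$ and every $\theta'_i\in R(\theta_i)$: $f(\theta_i,\theta'_{-i})\succsim_i f(\theta'_i,\theta'_{-i})$, where $\succsim_i$ is the preference in $\theta_i$. PE. $f$ is Pareto efficient if for every instance there is no outcome $o\in\mathcal{O}$ with $o\succsim_i f(\theta)$ for all participating voters $i\in N$ and $o\succ_i f(\theta)$ for some $i\in N$. AN-S. In an instance, let $N_S(k)$ be the set of participating voters having exactly $k$ children. $f$ satisfies AN-S if for every instance, every $k\ge 0$, and every instance obtained from it by permuting the preferences among voters in $N_S(k)$ (leaving the network and all other preferences unchanged), the outcome of $f$ is unchanged. *)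

(* Defs.v *)
From HB Require Import structures.
From mathcomp Require Import all_boot all_order all_algebra.
From mathcomp Require Import finmap.
From mathcomp Require Import all_classical all_reals.
From mathcomp Require Import interval_inference.

Set Implicit Arguments.
Unset Strict Implicit.
Unset Printing Implicit Defensive.

Import Order.TTheory GRing.Theory Num.Theory.

Local Open Scope fset_scope.
Local Open Scope fmap_scope.
Local Open Scope ring_scope.

Section Preferences.
Variable R : realType.

(* [w x y] reads "x is weakly preferred to y". *)
Definition strict_part (w : rel {i01 R}) : rel {i01 R} :=
  fun x y => w x y && ~~ w y x.

Definition single_peaked (w : rel {i01 R}) : Prop :=
  exists p : {i01 R}, forall x y : {i01 R},
    (p%:num <= x%:num < y%:num) || (y%:num < x%:num <= p%:num) ->
    strict_part w x y.

Record preference := Preference {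
  weak_pref :> rel {i01 R};
  weak_pref_total : total weak_pref;
  weak_pref_trans : transitive weak_pref;
  weak_pref_single_peaked : single_peaked weak_pref }.

End Preferences.

Section Networks.
Variables (R : realType) (V : choiceType).

(* The requirement that a voter is not her own child is in [is_instance]. *)
Definition voter_type : Type := (preference R * {fset V})%type.

Definition type_profile : Type := {fmap V -> voter_type}.

Implicit Types (rm : {fset V}) (theta : type_profile).

Definition children theta (i : V) : {fset V} :=
  if theta.[? i] is Some t then t.2 else fset0.

Definition preference_of theta (i : V) : option (preference R) :=
  omap fst theta.[? i].

(* The nodes of the graph: [None] is the moderator, [Some i] is voter [i]. *)
Definition edge rm theta : rel (option V) := fun x y =>
  match x, y with
  | None, Some j => j \in rm
  | Some i, Some j => j \in children theta i
  | _, None => false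
  end.

Definition path_to rm theta (i : V) (p : seq (option V)) : Prop :=
  path (edge rm theta) None p /\ last None p = Some i.

(* A path may revisit nodes, so the uniqueness in [inst_tree] excludes cycles
   and every edge that is not on the path from the moderator to its target. *)
Record is_instance rm theta : Prop := IsInstance {
  inst_root_neq0 : rm != fset0;
  inst_root_sub : rm `<=` domf theta;
  inst_irrefl : forall i, i \in domf theta -> i \notin children theta i;
  inst_children_sub :
    forall i, i \in domf theta -> children theta i `<=` domf theta;
  inst_tree :
    forall i, i \in domf theta -> exists! p, path_to rm theta i p }.

Record instance := Instance {
  root_children : {fset V};
  profile : type_profile;
  instanceP : is_instance root_children profile }.

Definition voters (I : instance) : {fset V} := domf (profile I).

(* Only the inclusion of the children is to be checked: every preference is
   single-peaked by typing and may be reported. *)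
Definition is_report theta theta' : Prop :=
  domf theta' = domf theta /\
  forall i, i \in domf theta -> children theta' i `<=` children theta i.

Definition report (I : instance) : Type :=
  {theta' : type_profile | is_report (profile I) theta'}.

Definition participants rm theta : {fset V} :=
  [fset i in domf theta | `[< exists p, path_to rm theta i p >]].

Definition participating rm theta : type_profile :=
  theta.[& participants rm theta].

Lemma children_notin theta i : i \notin domf theta -> children theta i = fset0.
Proof. by move=> ni; rewrite /children not_fnd. Qed.

Lemma children_participating rm theta i : i \in participants rm theta ->
  children (participating rm theta) i = children theta i.
Proof. by move=> hi; rewrite /children fnd_restrict hi. Qed.

Lemma in_participants rm theta i : (i \in participants rm theta) =
  (i \in domf theta) && `[< exists p, path_to rm theta i p >].
Proof. by rewrite /participants !inE. Qed.

Lemma domf_participating rm theta :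
  domf (participating rm theta) = participants rm theta.
Proof.
apply/fsetP => i; rewrite mem_restrictf andbC in_participants.
by case: (i \in domf theta); rewrite ?andbF.
Qed.

Lemma edge_participating rm theta :
  subrel (edge rm (participating rm theta)) (edge rm theta).
Proof.
move=> [i|] [j|] //=; case: (boolP (i \in participants rm theta)) => hi.
  by rewrite children_participating.
by rewrite children_notin ?domf_participating.
Qed.

Lemma edge_report rm theta theta' :
  is_report theta theta' -> subrel (edge rm theta') (edge rm theta).
Proof.
move=> [hd hc] [i|] [j|] //=; case: (boolP (i \in domf theta)) => hi.
  exact: (fsubsetP (hc i hi)).
by rewrite children_notin ?hd.
Qed.

Lemma path_participating rm theta i p : path_to rm theta i p ->
    (forall x y, edge rm theta x (Some y) -> y \in domf theta) ->
  path_to rm (participating rm theta) i p.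
Proof.
move=> [hp hl] hdom; split=> // {i hl}.
elim/last_ind: p hp => // p y IHp; rewrite !rcons_path => /andP[hp hy].
rewrite IHp //=; move: hy; case: (lastP p) hp => [|q x] //.
rewrite last_rcons; case: x y => [x|] [y|] // hq.
have hx : x \in participants rm theta.
  rewrite in_participants; apply/andP; split.
    by move: hq; rewrite rcons_path => /andP[_ /hdom].
  by apply/asboolP; exists (rcons q (Some x)); split=> //; rewrite last_rcons.
by rewrite /= children_participating.
Qed.

Lemma participating_instance (I : instance) (theta' : report I) :
  is_instance (root_children I)
    (participating (root_children I) (sval theta')).
Proof.
case: I theta' => rm theta [h0 hr hi hs ht] [theta' /= hrep].
have [hd hc] := hrep.
have hdom x y : edge rm theta' x (Some y) -> y \in domf theta'.
  move/(edge_report hrep); rewrite hd; case: x => [x|] /=; last exact: fsubsetP.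
  case: (boolP (x \in domf theta)) => hx; first exact: (fsubsetP (hs x hx)).
  by rewrite children_notin.
split=> //.
- apply/fsubsetP => i ir; rewrite domf_participating in_participants.
  rewrite hd (fsubsetP hr _ ir) /=; apply/asboolP.
  by exists [:: Some i]; split=> //=; rewrite ir.
- move=> i; rewrite domf_participating => ip.
  rewrite children_participating //.
  have id : i \in domf theta by move: ip; rewrite in_participants hd => /andP[].
  by apply: contra (hi i id); apply: (fsubsetP (hc i id)).
- move=> i; rewrite domf_participating => ip.
  rewrite children_participating //; apply/fsubsetP => j jc.
  move: ip; rewrite !in_participants => /andP[id /asboolP[p [hp hl]]].
  rewrite (hdom (Some i) j jc) /=; apply/asboolP; exists (rcons p (Some j)).
  by split; rewrite ?last_rcons // rcons_path hp hl.
- move=> i; rewrite domf_participating in_participants.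
  case/andP=> id /asboolP[p hp]; exists p; split.
    exact: path_participating.
  move=> q [hq lq]; have id' : i \in domf theta by rewrite -hd.
  have [r [_ hu]] := ht i id'; have [pp lp] := hp.
  rewrite -(hu p); first apply: hu; split=> //.
    by apply: sub_path hq => x y /edge_participating; exact: edge_report.
  by apply: sub_path pp; exact: edge_report.
Qed.

Definition reported_instance (I : instance) (theta' : report I) : instance :=
  Instance (participating_instance theta').

Definition scf : Type := instance -> {i01 R}.

(* [theta1] and [theta2] range over the reported profiles that differ at most
   in the report of [i], with [i] truthful in [theta1]. *)
Definition strategy_proof (f : scf) : Prop :=
  forall (I : instance) (i : V) (t : voter_type),
    (profile I).[? i] = Some t ->
  forall theta1 theta2 : report I,
    (sval theta1).[? i] = Some t ->
    (forall j, j != i -> (sval theta1).[? j] = (sval theta2).[? j]) ->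
    weak_pref t.1 (f (reported_instance theta1)) (f (reported_instance theta2)).

Definition pareto_efficient (f : scf) : Prop :=
  forall I : instance,
    ~ exists o : {i01 R},
        (forall i w, preference_of (profile I) i = Some w ->
           weak_pref w o (f I)) /\
        (exists i w, preference_of (profile I) i = Some w /\
           strict_part w o (f I)).

Definition voters_with_children (I : instance) (k : nat) : {fset V} :=
  [fset i in voters I | #|` children (profile I) i| == k].

Definition anonymous_on_structures (f : scf) : Prop :=
  forall (I J : instance) (k : nat) (s : V -> V),
    bijective s ->
    (forall i, i \notin voters_with_children I k -> s i = i) ->
    root_children J = root_children I ->
    voters J = voters I ->
    (forall i, children (profile J) i = children (profile I) i) ->
    (forall i, preference_of (profile J) i = preference_of (profile I) (s i)) ->
    f J = f I.

End Networks.

(* Main.v *)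
(* Along the chain m -> a -> b -> c the voter a can hide b and so be the only
   participant, which by efficiency yields her peak; strategy-proofness then
   makes her a dictator.  But a and b both have exactly one child, so anonymity
   on structures lets them exchange their preferences without changing the
   outcome: impossible when their peaks differ. *)

Require Import Defs.
From mathcomp Require Import all_boot all_order all_algebra.
From mathcomp Require Import finmap.
From mathcomp Require Import all_classical all_reals.
From mathcomp Require Import interval_inference.

Set Implicit Arguments.
Unset Strict Implicit.
Unset Printing Implicit Defensive.

Import Order.TTheory GRing.Theory Num.Theory.

Local Open Scope fset_scope.
Local Open Scope fmap_scope.
Local Open Scope ring_scope.

(** * Preferences with peak at either end of the interval *)

Section Preferences.
Variable R : realType.
Implicit Types (w : preference R) (p x y : {i01 R}).

(** The peak enters the argument as the unique best outcome: this is what efficiency and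
    strategy-proofness can detect. *)
Definition is_peak w p : Prop := forall x, x != p -> strict_part w p x.

Lemma weak_pref_peak w p x : is_peak w p -> weak_pref w x p -> x = p.
Proof.
move=> wp wx; apply/eqP; apply/negPn/negP => /wp.
by rewrite /strict_part wx andbF.
Qed.

Lemma weak_pref_refl w x : weak_pref w x x.
Proof. by have := weak_pref_total w x x; rewrite orbb. Qed.

Lemma peak_weak_pref w p x : is_peak w p -> weak_pref w p x.
Proof.
move=> wp; have [->|/wp /andP[]//] := eqVneq x p; exact: weak_pref_refl.
Qed.

Definition lower_rel : rel {i01 R} := fun x y => x%:num <= y%:num.
Definition upper_rel : rel {i01 R} := fun x y => y%:num <= x%:num.

Lemma lower_single_peaked : single_peaked lower_rel.
Proof.
exists 0%:i01 => x y /orP[/andP[_]|/andP[yx x0]]; last first.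
  (* The left side of the peak is vacuous, since no outcome lies below 0. *)
  by have := lt_le_trans yx x0; rewrite /= ltNge ge0.
by rewrite /strict_part /lower_rel => xy; rewrite ltW //= -ltNge.
Qed.

Lemma upper_single_peaked : single_peaked upper_rel.
Proof.
exists 1%:i01 => x y /orP[/andP[x1 xy]|/andP[+ _]].
  by have := le_lt_trans x1 xy; rewrite /= ltNge le1.
by rewrite /strict_part /upper_rel => xy; rewrite ltW //= -ltNge.
Qed.

Lemma lower_total : total lower_rel.
Proof. by move=> x y; exact: le_total. Qed.

Lemma upper_total : total upper_rel.
Proof. by move=> x y; exact: le_total. Qed.

Lemma lower_trans : transitive lower_rel.
Proof. by move=> y x z; exact: le_trans. Qed.

Lemma upper_trans : transitive upper_rel.
Proof. by move=> y x z yx zy; exact: le_trans zy yx. Qed.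

Definition lower_pref : preference R :=
  Preference lower_total lower_trans lower_single_peaked.

Definition upper_pref : preference R :=
  Preference upper_total upper_trans upper_single_peaked.

Lemma lower_pref_peak : is_peak lower_pref 0%:i01.
Proof.
move=> x x0; rewrite /strict_part /= /lower_rel /= ge0 /= -ltNge.
rewrite lt_neqAle ge0 andbT eq_sym; apply: contra x0 => /eqP xE.
exact/eqP/val_inj.
Qed.

Lemma upper_pref_peak : is_peak upper_pref 1%:i01.
Proof.
move=> x x1; rewrite /strict_part /= /upper_rel /= le1 /= -ltNge.
rewrite lt_neqAle le1 andbT; apply: contra x1 => /eqP xE.
exact/eqP/val_inj.
Qed.

End Preferences.

(** * Truthful reports and hidden children *)

Section Networks.
Variables (R : realType) (V : choiceType).
Implicit Types (I J : instance R V) (f : scf R V) (a b c i : V).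
Implicit Types (w : preference R).

(** An [scf] receives the well-formedness proof along with the data; proof irrelevance makes its
    value depend on the data alone. *)
Lemma instance_eq I J :
  root_children I = root_children J -> profile I = profile J -> I = J.
Proof.
case: I J => [rm th Ip] [rm' th' Jp] /= erm eth.
by case: _ / erm Jp; case: _ / eth => Jp; rewrite (Prop_irrelevance Ip Jp).
Qed.

Lemma truthful_is_report I : is_report (profile I) (profile I).
Proof. by []. Qed.

Definition truthful_report I : report I := exist _ _ (truthful_is_report I).

(** By [inst_tree] every voter is reachable from the moderator, so restricting to the participants
    drops nobody. *)
Lemma reported_truthful I : reported_instance (truthful_report I) = I.
Proof.
apply: instance_eq => //=; apply/fmapP => i.
rewrite fnd_restrict in_participants.
case: (boolP (i \in domf (profile I))) => iI /=; last by rewrite not_fnd.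
have [p [pi _]] := inst_tree (instanceP I) iI.
by rewrite asboolT //; exists p.
Qed.

Definition hide_children I a w : type_profile R V :=
  (profile I).[a <- (w, fset0)].

Lemma hide_children_is_report I a w : a \in voters I ->
  is_report (profile I) (hide_children I a w).
Proof.
move=> aI; split=> [|i _].
  by rewrite /hide_children dom_setf; apply/fsetUidPr; rewrite fsub1set.
rewrite /children fnd_set; case: eqP => // _; exact: fsub0set.
Qed.

Lemma sole_root_dictates f I a w p :
  strategy_proof f -> pareto_efficient f ->
  root_children I = [fset a] -> preference_of (profile I) a = Some w ->
  is_peak w p -> f I = p.
Proof.
move=> fSP fPE rI prefa wp.
have [r Ia] : exists r, (profile I).[? a] = Some (w, r).
  move: prefa; rewrite /preference_of.
  by case: ((profile I).[? a]) => //= -[w' r] [->]; exists r.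
have aI : a \in voters I by rewrite /voters -fndSome Ia.
pose hidden : report I := exist _ _ (hide_children_is_report w aI).
have only_a i w' :
    preference_of (profile (reported_instance hidden)) i = Some w' ->
    i = a /\ w' = w.
  rewrite /preference_of /= fnd_restrict in_participants.
  case: ifP => // /andP[_ /asboolP[q [qpath qlast]]].
  (* A path from the moderator must enter [a] first and stops there, as [a] reports no children. *)
  have -> : i = a.
    case: q qpath qlast => [|[x|] q] //=.
    rewrite rI inE => /andP[/eqP ->]; case: q => [_ []//|[y|] q] //=.
    by rewrite /children fnd_set eqxx inE.
  by rewrite fnd_set eqxx => -[<-].
have pa : preference_of (profile (reported_instance hidden)) a = Some w.
  rewrite /preference_of /= fnd_restrict in_participants ifT.
    by rewrite fnd_set eqxx.
  rewrite dom_setf !inE eqxx /=; apply/asboolP; exists [:: Some a].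
  by split=> //=; rewrite rI inE eqxx.
have fhidden : f (reported_instance hidden) = p.
  (* Any other outcome would be Pareto dominated by [p], with [a] the only participant. *)
  apply/eqP; apply/negPn/negP => /wp better.
  apply: (fPE (reported_instance hidden)); exists p; split.
    by move=> i w' /only_a[_ ->]; exact: peak_weak_pref.
  by exists a, w.
(* Hiding yields [p], so truth-telling must give [a] something at least as good as her peak, which
   only [p] is. Both outcomes are written as values at reports, to fit strategy-proofness. *)
apply: (weak_pref_peak wp); rewrite -fhidden -[X in f X](reported_truthful I).
apply: (fSP _ _ _ Ia) => //= j ja.
by rewrite /hide_children fnd_set (negPf ja).
Qed.

(** The tail voter [c] is there to give [b] a child: on a chain of two, [a] and [b] would have
    different numbers of children and could not be exchanged. *)
Definition chain_profile a b c (wa wb wc : preference R) : type_profile R V :=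
  [fmap].[c <- (wc, fset0)].[b <- (wb, [fset c])].[a <- (wa, [fset b])].

(** * The chain as a tree, and the exchange of its first two voters *)

Section Chain.
Variables (a b c : V).
Hypotheses (ab : a != b) (ac : a != c) (bc : b != c).

Lemma chain_fnd wa wb wc i : (chain_profile a b c wa wb wc).[? i] =
  if i == a then Some (wa, [fset b]) else
  if i == b then Some (wb, [fset c]) else
  if i == c then Some (wc, fset0) else None.
Proof. by rewrite /chain_profile !fnd_set fnd_fmap0. Qed.

Lemma chain_children wa wb wc i : children (chain_profile a b c wa wb wc) i =
  if i == a then [fset b] else if i == b then [fset c] else fset0.
Proof. by rewrite /children chain_fnd; do 3?case: ifP. Qed.

Lemma chain_dom wa wb wc :
  domf (chain_profile a b c wa wb wc) = [fset a; b; c].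
Proof.
by apply/fsetP => i; rewrite -fndSome chain_fnd !inE; do 3?case: ifP.
Qed.

(** The edges do not depend on the preferences, so the tree property is checked on one fixed
    relation. *)
Definition chain_rel : rel (option V) := fun x y =>
  [|| (x == None) && (y == Some a), (x == Some a) && (y == Some b)
    | (x == Some b) && (y == Some c)].

Lemma chain_edge wa wb wc :
  edge [fset a] (chain_profile a b c wa wb wc) = chain_rel.
Proof.
apply/funext => x; apply/funext => y; rewrite /chain_rel.
case: x y => [x|] [y|] //=; rewrite ?andbF //.
- rewrite chain_children !(inj_eq Some_inj).
  have [->|xa] := eqVneq x a; first by rewrite inE (negPf ab) orbF.
  by case: eqP => _; rewrite inE.
- by rewrite inE orbF.
Qed.

Lemma chain_instance wa wb wc :
  is_instance [fset a] (chain_profile a b c wa wb wc).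
Proof.
have [ba ca cb] : [/\ b != a, c != a & c != b].
  by split; rewrite eq_sym.
split.
- by apply/fset0Pn; exists a; rewrite inE.
- by rewrite chain_dom fsub1set !inE eqxx.
- move=> i _; rewrite chain_children.
  by case: eqP => [->|_]; [rewrite inE|case: eqP => [->|_]; rewrite inE].
- move=> i _; rewrite chain_children chain_dom.
  case: eqP => _; [|case: eqP => _];
    by rewrite ?fsub0set ?fsub1set ?inE ?eqxx ?orbT.
- move=> i; rewrite chain_dom /path_to chain_edge.
  (* The paths from the moderator are the prefixes of the chain. Their endpoints differ, so each
     voter is reached by exactly one of them. *)
  have path_chain q : path chain_rel None q -> [\/ q = [::], q = [:: Some a],
      q = [:: Some a; Some b] | q = [:: Some a; Some b; Some c]].
    case: q => [|x q] /=; first by constructor 1.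
    rewrite /chain_rel orbF => /andP[/eqP ->].
    case: q => [|y q] /=; first by constructor 2.
    rewrite /chain_rel /= !(inj_eq Some_inj) eqxx (negPf ab) orbF.
    case/andP=> /eqP ->; case: q => [|z q] /=; first by constructor 3.
    rewrite /chain_rel /= !(inj_eq Some_inj) eqxx (negPf ba).
    case/andP=> /eqP ->; case: q => [|t q] /=; first by constructor 4.
    by rewrite /chain_rel /= !(inj_eq Some_inj) (negPf ca) (negPf cb).
  have ea : chain_rel None (Some a) by rewrite /chain_rel !eqxx.
  have eb : chain_rel (Some a) (Some b) by rewrite /chain_rel !eqxx.
  have ec : chain_rel (Some b) (Some c) by rewrite /chain_rel !eqxx !orbT.
  rewrite !inE -orbA => /or3P[] /eqP ->.
  + exists [:: Some a]; split=> [|q [/path_chain[] -> //= [] /eqP]].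
    * by split; rewrite //= ea.
    * by rewrite (negPf ba).
    * by rewrite (negPf ca).
  + exists [:: Some a; Some b]; split=> [|q [/path_chain[] -> //= [] /eqP]].
    * by split; rewrite //= ea eb.
    * by rewrite (negPf ab).
    * by rewrite (negPf cb).
  + exists [:: Some a; Some b; Some c].
    split=> [|q [/path_chain[] -> //= [] /eqP]].
    * by split; rewrite //= ea eb ec.
    * by rewrite (negPf ac).
    * by rewrite (negPf bc).
Qed.

Definition chain wa wb wc : instance R V := Instance (chain_instance wa wb wc).

Lemma chain_swap f wa wb wc : anonymous_on_structures f ->
  f (chain wa wb wc) = f (chain wb wa wc).
Proof.
move=> fAN; have ba : b != a by rewrite eq_sym.
pose s i := if i == a then b else if i == b then a else i.
have sK : involutive s.
  move=> i; rewrite /s; have [->|ia] := eqVneq i a.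
    by rewrite (negPf ba) eqxx.
  have [->|ib] := eqVneq i b; first by rewrite eqxx.
  by rewrite (negPf ia) (negPf ib).
(* The transposition [s] moves [a] and [b] only, and both have one child, hence the class
   [k = 1]. *)
apply: (fAN _ _ 1%N s) => //=.
- exact: inv_bij.
- move=> i; rewrite /voters_with_children !inE /= chain_children /s.
  have [->|ia] := eqVneq i a; first by rewrite cardfs1.
  by have [->|ib] := eqVneq i b; first by rewrite cardfs1.
- by move=> i; rewrite !chain_children.
- move=> i; rewrite /preference_of !chain_fnd /s.
  have [_|ia] := eqVneq i a; first by rewrite (negPf ba) eqxx.
  have [_|ib] := eqVneq i b; first by rewrite eqxx.
  by rewrite (negPf ia) (negPf ib); case: ifP.
Qed.

End Chain.

End Networks.

Theorem theorem2 (R : realType) (V : choiceType)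
    (V_infinite : infinite_set [set: V]) :
  ~ exists f : scf R V,
      [/\ strategy_proof f, pareto_efficient f & anonymous_on_structures f].
Proof.
case=> f [fSP fPE fAN].
(* Infinitely many potential voters supply the three distinct ones of the chain. *)
have [X _ X3] := infinite_set_fset 3 V_infinite.
have [a [b [c [ab ac bc]]]] : exists a b c : V, [/\ a != b, a != c & b != c].
  move: (fset_uniq X) X3; case: (enum_fset X) => [|a [|b [|c s]]] //=.
  rewrite !inE !negb_or -!andbA => /and5P[ab ac _ bc _] _.
  by exists a, b, c.
pose l := lower_pref R; pose u := upper_pref R.
have dictates wa wb p : is_peak wa p -> f (chain ab ac bc wa wb l) = p.
  apply: (sole_root_dictates (a := a)) => //=.
  by rewrite /preference_of chain_fnd eqxx.
(* The exchange keeps the outcome, while the dictator's peak moves from 0 to 1. The preference of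
   [c] is an arbitrary choice, the same on both sides. *)
have := chain_swap ab ac bc l u l fAN.
rewrite (dictates _ _ _ (@lower_pref_peak R)).
rewrite (dictates _ _ _ (@upper_pref_peak R)).
by move/(congr1 (fun x : {i01 R} => x%:num))/eqP; rewrite /= eq_sym oner_eq0.
Qed.
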